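(* Let $a,b,c$ be events. If $[a\;b\;c]$ then $[c\;b\;a]$, and no other order of these events holds; that is, none of $[b\;a\;c]$, $[a\;c\;b]$, $[b\;c\;a]$, $[c\;a\;b]$ holds.
   Context: Let $\mathcal E$ be a set, whose elements are called events; let $\mathcal P$ be a set of subsets of $\mathcal E$, whose elements are called paths; and let $[\,\cdot\;\cdot\;\cdot\,]$ be a ternary relation (betweenness) on $\mathcal E$. The following axioms are assumed. (I1) $\mathcal E\neq\emptyset$. (I2) For distinct events $a,b$ there are paths $R\ni a$, $S\ni b$ with $R\cap S\ne\emptyset$. (I3) For any two distinct events there is at most one path containing both. (O1) If $[a\;b\;c]$ then some path contains $a,b,c$. (O2) $[a\;b\;c]\Rightarrow[c\;b\;a]$. (O3) $[a\;b\;c]\Rightarrow a\neq c$. (O4) $[a\;b\;c]$ and $[b\;c\;d]$ imply $[a\;b\;d]$ (no distinctness of $a,d$ is assumed). (O5) If $a,b,c$ are distinct events of one path, then $[a\;b\;c]$ or $[b\;c\;a]$ or $[c\;a\;b]$. *)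

(* Defs.v *)
From mathcomp Require Import all_boot.
From mathcomp Require Import classical_sets.

Set Implicit Arguments.
Unset Strict Implicit.
Unset Printing Implicit Defensive.

Local Open Scope classical_set_scope.

(* The set of events is the whole type [Event]; [btw a b c] is the betweenness
   relation written [a b c], with no distinctness built in. *)
Record event_path_axioms (Event : Type) (paths : set (set Event))
    (btw : Event -> Event -> Event -> Prop) : Prop := EventPathAxioms {
  axI1 : [set: Event] !=set0;
  axI2 : forall a b : Event, a <> b ->
    exists R S : set Event,
      [/\ paths R, paths S, R a, S b & R `&` S !=set0];
  axI3 : forall a b : Event, a <> b ->
    forall Q R : set Event, paths Q -> paths R ->
      Q a -> Q b -> R a -> R b -> Q = R;
  axO1 : forall a b c : Event, btw a b c ->
    exists Q : set Event, [/\ paths Q, Q a, Q b & Q c];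
  axO2 : forall a b c : Event, btw a b c -> btw c b a;
  axO3 : forall a b c : Event, btw a b c -> a <> c;
  axO4 : forall a b c d : Event, btw a b c -> btw b c d -> btw a b d;
  axO5 : forall (Q : set Event) (a b c : Event), paths Q ->
    Q a -> Q b -> Q c -> a <> b -> b <> c -> a <> c ->
    [\/ btw a b c, btw b c a | btw c a b]
}.

(* Main.v *)
(* Each forbidden order, possibly reversed by O2, chains with [a b c] under O4
   taken with coinciding endpoints, giving some [x y x], against O3. *)
Require Import Defs.
From mathcomp Require Import all_boot.
From mathcomp Require Import classical_sets.

(** O4 allows [d = a], so [a b c] and [b c a] would chain to [a b a], which O3 forbids: an order
    excludes its cyclic rotation. Up to the reversal O2, the four forbidden orders are just the two
    rotations of [a b c]. *)

Lemma btw_not_rot {Event : Type} {paths : set (set Event)}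
    {btw : Event -> Event -> Event -> Prop}
    (ax : event_path_axioms paths btw) {a b c : Event} :
  btw a b c -> ~ btw b c a.
Proof. by move=> abc bca; exact: (axO3 ax (axO4 ax abc bca)). Qed.

Theorem theorem1 (Event : Type) (paths : set (set Event))
    (btw : Event -> Event -> Event -> Prop)
    (ax : event_path_axioms paths btw) (a b c : Event) (habc : btw a b c) :
  btw c b a /\
  [/\ ~ btw b a c, ~ btw a c b, ~ btw b c a & ~ btw c a b].
Proof.
have not_bca := btw_not_rot ax habc.
(* The roles are exchanged: [a b c] is itself the rotation of [c a b]. *)
have not_cab : ~ btw c a b by move=> cab; exact: (btw_not_rot ax cab habc).
split; first exact: (axO2 ax habc).
(* By O2, [b a c] reverses to [c a b], and [a c b] to [b c a]. *)
by split=> // h; [apply: not_cab | apply: not_bca]; exact: (axO2 ax h).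
Qed.
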